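(* Let $G$ be a second-countable profinite group, let $\mu$ be the normalized Haar measure on $G$, and let $T: G \to G$ be a quotient-preserving map. Let $\mathcal{F}(T)$ be the finite factor set of $T$, and let $\mathcal{F} \subseteq \mathcal{F}(T)$ be a base for the neighborhoods of the identity $e \in G$. For each $N \in \mathcal{F}(T)$ let $T_N: G/N \to G/N$ denote the map induced by $T$. Then the following are equivalent: (1) $T$ is measure-preserving with respect to $\mu$ (equivalently, $T$ is nonsingular with respect to $\mu$); (2) $T_N$ is bijective for each $N \in \mathcal{F}$; (3) $T$ is surjective; (4) there exists a translation invariant metric $d$ on $G$ inducing the topology of $G$ such that $T$ is an isometry with respect to $d$ and such that the subset of $\mathcal{F}$ consisting of those sets that are balls of some radius with respect to $d$ is a base for the neighborhoods of $e \in G$. Also, the following are equivalent: (1') $T$ is measure-preserving and ergodic with respect to $\mu$; (2') $T_N$ is measure-preserving and ergodic with respect to $\mu_{G/N}$ for each $N \in \mathcal{F}$; (3') $T_N$ is minimal for each $N \in \mathcal{F}$.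
   Context: A profinite group is a topological group isomorphic to an inverse limit of finite discrete groups (equivalently, a compact Hausdorff totally disconnected topological group). $N \lhd_O G$ means that $N$ is an open normal subgroup of $G$; $\pi_N: G \to G/N$ is the quotient map. A map $T: G\to G$ (not assumed to be a homomorphism) factors through $\pi_N$ if there is a map $T_N: G/N \to G/N$ with $\pi_N \circ T = T_N \circ \pi_N$; this $T_N$ is the induced map. The finite factor set of $T$ is $\mathcal{F}(T) = \{ N \lhd_O G : T \text{ factors through } \pi_N: G \to G/N\}$. $T$ is a quotient-preserving map if the cosets of the elements of $\mathcal{F}(T)$ form a base for the topology of $G$. $\mu$ is the Haar probability measure on the Borel $\sigma$-algebra of $G$, and $\mu_{G/N}$ is the normalized counting measure on the finite group $G/N$ (all subsets measurable). For a probability space $(X,\mathcal{B},\mu)$ and a measurable $S: X\to X$: $S$ is measure-preserving if $\mu(S^{-1}A)=\mu(A)$ for all $A\in\mathcal{B}$; $S$ is nonsingular if for all $A \in \mathcal{B}$, $\mu(S^{-1}A)=0$ if and only if $\mu(A)=0$; $S$ is ergodic if every $A\in\mathcal{B}$ with $S^{-1}A=A$ has $\mu(A)\in\{0,1\}$. A self-map of a finite set is minimal if the forward orbit of every point is the whole set. A metric $d$ on $G$ is translation invariant if $d(gx,gy)=d(x,y)=d(xg,yg)$ for all $x,y,g\in G$. A subgroup $N$ is a ball with respect to $d$ if $N=\{x\in G: d(e,x)\le r\}$ for some $r>0$. *)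

(* Defs.v *)
From HB Require Import structures.
From mathcomp Require Import all_boot all_order all_algebra.
From mathcomp Require Import all_classical all_reals all_analysis.

Set Implicit Arguments.
Unset Strict Implicit.
Unset Printing Implicit Defensive.

Import Order.TTheory GRing.Theory Num.Theory.
Local Open Scope classical_set_scope.
Local Open Scope ring_scope.

HB.mixin Record isTopologicalGroup G & Topological G & Group G := {
  mulg_continuous : continuous (fun x : G * G => (x.1 * x.2)%g) ;
  invg_continuous : continuous (fun x : G => x^-1%g)
}.

(* The base point plays no role: it is there because the library only equips
   pointed types with a generated sigma-algebra. *)
#[short(type="topologicalGroupType")]
HB.structure Definition TopologicalGroup :=
  {G of PointedTopological G & Group G & isTopologicalGroup G}.

Definition profinite (G : topologicalGroupType) : Prop :=
  [/\ compact [set: G], hausdorff_space G & totally_disconnected [set: G]].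

Definition nbhs_base (X : topologicalType) (x : X) (B : set (set X)) : Prop :=
  B `<=` nbhs x /\ forall U, nbhs x U -> exists2 V, B V & V `<=` U.

Section cosets.
Variable G : topologicalGroupType.
Implicit Type N : set G.

Definition open_normal_subgroup N : Prop :=
  [/\ open N, group_closed [in N] & forall x g : G, N x -> N (x ^ g)%g].

Definition left_coset N (x : G) : set G := [set (x * n)%g | n in N].

(* G/N as a set; its group structure is not needed *)
Definition coset_space N : Type := set_type (range (left_coset N)).

Definition coset_proj N (x : G) : coset_space N :=
  SigSub (mem_set (imageT (left_coset N) x)).

HB.instance Definition _ N := Choice.on (coset_space N).
HB.instance Definition _ N := isPointed.Build (coset_space N) (coset_proj N 1%g).

HB.instance Definition _ N :=
  @isMeasurable.Build default_measure_display (coset_space N)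
    [set: set (coset_space N)] I (fun _ _ => I) (fun _ _ => I).

Definition induces (T : G -> G) N (TN : coset_space N -> coset_space N) : Prop :=
  coset_proj N \o T = TN \o coset_proj N.

Definition finite_factor_set (T : G -> G) : set (set G) :=
  [set N | open_normal_subgroup N /\ exists TN, @induces T N TN].

Definition quotient_preserving (T : G -> G) : Prop :=
  basis [set C | exists N x, finite_factor_set T N /\ C = left_coset N x].

End cosets.

Notation borel G := (g_sigma_algebraType (@open G)).

(* On a second-countable compact group every Borel probability measure is
   regular, so invariance and normalization characterize Haar measure. *)
Definition is_haar (R : realType) (G : topologicalGroupType)
    (mu : probability (borel G) R) : Prop :=
  forall (g : G) (A : set (borel G)), measurable A ->
    mu [set (g * a)%g | a in (A : set G)] = mu A.

(* The library's [counting] takes values in the extended reals; an open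
   subgroup of a compact group has finite index, so [fine] loses nothing. *)
Definition coset_index (R : realType) (G : topologicalGroupType) (N : set G) : R :=
  fine (@counting (coset_space N) R [set: coset_space N]).

Lemma coset_index_inv_ge0 (R : realType) (G : topologicalGroupType) (N : set G) :
  0 <= (coset_index R N)^-1.
Proof. by rewrite invr_ge0 fine_ge0. Qed.

Definition quotient_measure (R : realType) (G : topologicalGroupType)
    (N : set G) : {measure set (coset_space N) -> \bar R} :=
  mscale (NngNum (coset_index_inv_ge0 R N)) counting.

Section dynamics.
Context d (X : measurableType d) (R : realType).
Variables (mu : {measure set X -> \bar R}) (S : X -> X).

Definition measure_preserving : Prop :=
  measurable_fun [set: X] S /\
  forall A, measurable A -> mu (S @^-1` A) = mu A.

Definition nonsingular : Prop :=
  measurable_fun [set: X] S /\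
  forall A, measurable A -> mu (S @^-1` A) = 0%E <-> mu A = 0%E.

Definition ergodic : Prop :=
  measurable_fun [set: X] S /\
  forall A, measurable A -> S @^-1` A = A -> mu A = 0%E \/ mu A = 1%E.

End dynamics.

Definition minimal_map (X : Type) (S : X -> X) : Prop :=
  forall x, range (fun n => iter n S x) = [set: X].

Section metrics.
Variables (R : realType) (G : topologicalGroupType) (d : G -> G -> R).

Definition is_metric : Prop :=
  [/\ forall x y, 0 <= d x y,
      forall x y, d x y = 0 <-> x = y,
      forall x y, d x y = d y x &
      forall x y z, d x z <= d x y + d y z].

Definition induces_topology : Prop :=
  forall U : set G, open U <->
    forall x, U x -> exists2 r, 0 < r & [set y | d x y < r] `<=` U.

Definition translation_invariant : Prop :=
  forall x y g : G, d (g * x)%g (g * y)%g = d x y /\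
                    d (x * g)%g (y * g)%g = d x y.

Definition is_isometry (T : G -> G) : Prop :=
  forall x y, d (T x) (T y) = d x y.

Definition is_metric_ball (N : set G) : Prop :=
  exists2 r : R, 0 < r & N = [set x | d 1%g x <= r].

End metrics.

(* Main.v *)
Require Import Defs.
From HB Require Import structures.
From mathcomp Require Import all_boot all_order all_algebra.
From mathcomp Require Import all_classical all_reals all_analysis.

Set Implicit Arguments.
Unset Strict Implicit.
Unset Printing Implicit Defensive.

Import Order.TTheory GRing.Theory Num.Theory.

Local Open Scope classical_set_scope.

(** Everything is read off on the finite quotients. Only cosets matter, for
    two reasons. Haar measure gives every coset of an open normal subgroup
    [N] the mass [1 / k], [k] the index, so it projects to the normalized
    counting measure ([quotient_measureE]) and no coset is negligible.
    Conversely a finite measure that charges, for each [N] in a base at the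
    identity, all cosets of [N] equally is a multiple of Haar measure
    ([haar_unique]): a nested subfamily of the base has cosets forming a
    countable pi-system that generates the Borel sets.

    Suppose [T] is nonsingular. A coset outside the image of [TN N] would
    have empty preimage but positive mass; so [TN N] is onto, hence a
    bijection of a finite set. If all [TN N] are bijective, the image of [T]
    is compact and meets every coset, so [T] is onto. If [T] is onto, so is
    each [TN N], which is then a bijection; hence [T] preserves the level at
    which two points separate in a nested base, and this level defines the
    required metric ([coset_dist], [surjective_isometry]). Finally, if [T]
    is an isometry and [N] is a ball, then [TN N] is injective, so the
    preimage under [T] of a coset of [N] is a coset of [N]; the image of
    [mu] under [T] therefore charges cosets equally and equals [mu]
    ([factors_bijective_measure_preserving]).

    For ergodicity, invariance and ergodicity project to the quotients. A
    forward orbit of a permutation of a finite set is strictly invariant, so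
    ergodicity forces it to be everything ([ergodic_factor_minimal]). If all
    [TN N] are minimal they are bijective, so [T] preserves [mu]; for an
    invariant Borel set [A], the measure [B |-> mu (B /\ A)] has the same
    value on the cosets of [N] along a [TN N]-orbit, hence on all of them,
    so it equals [mu A * mu B], and [B = A] gives [mu A = mu A * mu A]
    ([factors_minimal_ergodic]). *)

(** * Self-maps of finite sets *)

Section finite_maps.
Context {X : Type} (finX : finite_set [set: X]).
Implicit Types f : X -> X.

(** Otherwise the orbit of [x] would embed [nat] into a finite set. *)
Lemma injective_periodic f : injective f ->
  forall x, exists n, iter n.+1 f x = x.
Proof.
move=> f_inj x; apply: contrapT => aperiodic; apply: infinite_nat.
have lt_neq i k : iter (i + k.+1) f x <> iter i f x.
  elim: i => [|i IHi] /=; last by move=> /f_inj.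
  by move=> period; apply: aperiodic; exists k.
rewrite -(preimage_setT (fun n => iter n f x)); apply: finite_preimage finX.
move=> i j _ _ eq_ij; case: (ltngtP i j) => // lt_ij; exfalso.
  by apply: (lt_neq i (j - i.+1)); rewrite addnS -addSn subnKC.
by apply: (lt_neq j (i - j.+1)); rewrite addnS -addSn subnKC.
Qed.

Lemma injective_bijective f : injective f -> bijective f.
Proof.
move=> f_inj; rewrite -setTT_bijective; split=> // [x y _ _ /f_inj //|y _].
by have [n <-] := injective_periodic f_inj y; exists (iter n f y).
Qed.

Lemma surjective_bijective f : (forall y, exists x, f x = y) -> bijective f.
Proof.
move=> /choice[g fgK].
have [h ghK hgK] := injective_bijective (can_inj fgK).
by exists g => // x; rewrite -[x in RHS]hgK -[in RHS](fgK (h x)) hgK.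
Qed.

(** The orbit of [f y] comes back to [y], so [y] is in the image. *)
Lemma minimal_bijective f : minimal_map f -> bijective f.
Proof.
move=> f_min; apply: surjective_bijective => y.
have [n _ ny] : range (fun n => iter n f (f y)) y by rewrite f_min.
by exists (iter n f y); rewrite -iterS iterSr.
Qed.

(** A forward orbit of a permutation of a finite set is strictly invariant,
    because points are periodic. *)
Lemma orbit_invariant f x : injective f ->
  f @^-1` range (fun n => iter n f x) = range (fun n => iter n f x).
Proof.
move=> f_inj; apply/seteqP; split=> y; last by case=> n _ <-; exists n.+1.
case=> -[|n] _ /=; last by move=> /f_inj <-; exists n.
move=> xfy; have [n] := injective_periodic f_inj x.
by rewrite {2}xfy => /f_inj <-; exists n.
Qed.

End finite_maps.

(** * Nested neighborhood bases *)

(** Each term is a member of [B] chosen inside the previous term and inside the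
    next set of a countable base. Nestedness is what turns cosets into a
    pi-system and makes the level at which two points separate an
    ultrametric. *)
Lemma nested_nbhs_base (X : ptopologicalType) (x : X) (B : set (set X)) :
    @second_countable X -> nbhs_base x B ->
  exists N : nat -> set X,
    [/\ forall k, B (N k), nonincreasing_seq N & nbhs_base x (range N)].
Proof.
move=> [V /pcard_surjP[e eV] [Vopen Vbase]] [Bnbhs Bbase].
have /choice[pick pickP] (U : set X) :
    exists N, nbhs x U -> B N /\ N `<=` U.
  have [/Bbase[N BN NU]|?] := pselect (nbhs x U); last by exists set0.
  by exists N.
pose level k : set X := if `[< V (e k) /\ e k x >] then e k else setT.
have level_nbhs k : nbhs x (level k).
  rewrite /level; case: asboolP => [[Vk kx]|_]; last exact: filterT.
  by apply: open_nbhs_nbhs; split => //; exact: Vopen.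
pose N := fix N k := pick (if k is k'.+1 then N k' `&` level k else level 0).
have Nnbhs k : B (N k).
  elim: k => [|k IHk] /=; apply: (proj1 (pickP _ _)) => //.
  by apply: filterI => //; exact: Bnbhs.
have Nlevel k : N k `<=` level k.
  case: k => [|k]; first exact: (proj2 (pickP _ _)).
  apply: subset_trans (@subIsetr _ (N k) _); apply: (proj2 (pickP _ _)).
  by apply: filterI => //; exact: Bnbhs.
exists N; split => //.
- apply/nonincreasing_seqP => k; apply/subsetPset => /=.
  apply: subset_trans (@subIsetl _ _ (level k.+1)); apply: (proj2 (pickP _ _)).
  by apply: filterI => //; exact: Bnbhs.
split=> [_ [k _ <-]|U /Vbase[W [VW Wx] WU]]; first exact: Bnbhs.
have [k _ kW] := eV W VW; exists (N k); first by exists k.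
apply: (subset_trans _ WU). apply: (subset_trans (@Nlevel k)).
by rewrite /level kW; rewrite asboolT.
Qed.

(** * Cosets of open normal subgroups *)

Section cosets.
Context {G : topologicalGroupType}.
Implicit Types (N : set G) (x y z : G).

Lemma left_cosetE N x y : left_coset N x y <-> N (x^-1 * y)%g.
Proof.
split=> [[n Nn <-]|Nxy]; first by rewrite mulKg.
by exists (x^-1 * y)%g; rewrite ?mulVKg.
Qed.

Lemma translate_continuous x : continuous (fun y => x * y)%g.
Proof.
move=> y; apply: (@continuous_comp _ _ _ (pair x) (fun p => p.1 * p.2)%g).
  by apply: cvg_pair; [exact: cvg_cst|exact: cvg_id].
exact: mulg_continuous.
Qed.

Lemma nbhs_translate x (U : set G) :
  nbhs x U -> nbhs 1%g ((fun y => x * y)%g @^-1` U).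
Proof. by move=> xU; apply: translate_continuous; rewrite /= mulg1. Qed.

Lemma open_left_coset N x : open N -> open (left_coset N x).
Proof.
have -> : left_coset N x = (fun y => x^-1 * y)%g @^-1` N.
  by apply/funext => y; apply/propext/left_cosetE.
by apply: open_comp => y _; exact: translate_continuous.
Qed.

Section subgroup.
Context {N : set G} (oN : open_normal_subgroup N).

Lemma subgroup1 : N 1%g.
Proof. by case: oN => _ [/set_mem]. Qed.

Lemma subgroup_div x y : N x -> N y -> N (x / y)%g.
Proof. by case: oN => _ [_ H] _ Nx Ny; apply/set_mem/H; exact/mem_set. Qed.

Lemma subgroupV x : N x -> N x^-1%g.
Proof. by rewrite -div1g; apply: subgroup_div subgroup1. Qed.

Lemma subgroupM x y : N x -> N y -> N (x * y)%g.
Proof. by move=> Nx /subgroupV; rewrite -{2}(invgK y); exact: subgroup_div. Qed.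

Lemma subgroup_divC x y : N (x^-1 * y)%g -> N (y^-1 * x)%g.
Proof. by move=> /subgroupV; rewrite invgM invgK. Qed.

Lemma subgroup_trans x y z :
  N (x^-1 * y)%g -> N (y^-1 * z)%g -> N (x^-1 * z)%g.
Proof. by move=> /subgroupM H /H; rewrite mulgA mulgK. Qed.

Lemma coset_projE x y : coset_proj N x = coset_proj N y <-> N (x^-1 * y)%g.
Proof.
split=> [/(congr1 val) /= eq_xy|Nxy].
  apply/left_cosetE; rewrite eq_xy; apply/left_cosetE.
  by rewrite mulVg; exact: subgroup1.
apply/val_inj/seteqP; split=> z /left_cosetE Nz; apply/left_cosetE.
  exact/(subgroup_trans _ Nz)/subgroup_divC.
exact: subgroup_trans Nz.
Qed.

Lemma coset_proj_preimage x :
  coset_proj N @^-1` [set coset_proj N x] = left_coset N x.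
Proof.
apply/seteqP; split=> y; last by move=> /left_cosetE/coset_projE.
by move=> /esym/coset_projE/left_cosetE.
Qed.

Lemma coset_proj_surj (c : coset_space N) : exists x, coset_proj N x = c.
Proof.
case: c => /= C C_coset; case: (set_mem C_coset) => x _ xC.
by exists x; apply/val_inj.
Qed.

Lemma coset_union_bigcup (A : set (coset_space N)) :
  coset_proj N @^-1` A = \bigcup_(c in A) (coset_proj N @^-1` [set c]).
Proof.
by apply/seteqP; split=> [x Ax|x [c Ac /= ->]//]; exists (coset_proj N x).
Qed.

(** Finitely many of the open cosets already cover the group. *)
Lemma finite_coset_space : compact [set: G] -> finite_set [set: coset_space N].
Proof.
rewrite compact_cover => /(_ _ [set: G] (left_coset N)).
case=> [x _|x _|D _ coverD].
- by apply: open_left_coset; case: oN.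
- by exists x => //; apply/left_cosetE; rewrite mulVg; exact: subgroup1.
apply: (sub_finite_set _ (finite_image (coset_proj N) (finite_fset D))) => c _.
have [x <-] := coset_proj_surj c; have [y Dy yx] := coverD x I.
by exists y => //; apply/coset_projE/left_cosetE.
Qed.

Lemma measurable_left_coset x :
  measurable (left_coset N x : set (borel G)).
Proof. by apply: sub_sigma_algebra; apply: open_left_coset; case: oN. Qed.

End subgroup.
End cosets.

(** * Measures that charge all cosets equally *)

Section coset_measures.
Local Open Scope ring_scope.
Context {R : realType} {G : topologicalGroupType}.
Hypothesis Gcompact : compact [set: G].
Implicit Types (m : {measure set (borel G) -> \bar R}) (N : set G).
Local Open Scope ereal_scope.

Lemma coset_union_measurable N (A : set (coset_space N)) :
  open_normal_subgroup N -> measurable (coset_proj N @^-1` A : set (borel G)).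
Proof.
move=> oN; rewrite coset_union_bigcup.
apply: (@fin_bigcup_measurable _ (borel G)).
  exact: sub_finite_set (finite_coset_space oN Gcompact).
move=> c _; have [x <-] := coset_proj_surj c.
by rewrite coset_proj_preimage//; exact: measurable_left_coset.
Qed.

Lemma measure_coset_union m N (A : set (coset_space N)) (a : \bar R) :
    open_normal_subgroup N -> (forall x, m (left_coset N x) = a) ->
  m (coset_proj N @^-1` A) = @counting _ R A * a.
Proof.
move=> oN m_const.
have finA : finite_set A.
  exact: sub_finite_set (finite_coset_space oN Gcompact).
rewrite coset_union_bigcup (@measure_fin_bigcup _ _ (borel G))//.
- rewrite (eq_fsbigr (fun=> a)) => [|c _]; last first.
    have [x <-] := coset_proj_surj c.
    by rewrite /= coset_proj_preimage.
  rewrite fsbig_finite//= /counting asboolT// mule_natl.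
  rewrite big_const_seq count_predT.
  by elim: (size _) => [|n IHn]; rewrite ?mule0n ?muleS /= ?IHn.
- exact: trivIset_preimage1.
- by move=> c _; exact: coset_union_measurable.
Qed.

Context {mu : probability (borel G) R} (mu_haar : is_haar mu).

Lemma haar_left_coset N x : open_normal_subgroup N ->
  mu (left_coset N x) = mu N.
Proof. by move=> oN; apply: mu_haar; apply: sub_sigma_algebra; case: oN. Qed.

Lemma coset_index_haar N : open_normal_subgroup N ->
  (coset_index R N)%:E * mu N = 1.
Proof.
move=> oN; rewrite /coset_index fineK; last first.
  by rewrite /counting asboolT//; exact: finite_coset_space.
rewrite -(measure_coset_union _ oN (fun x => haar_left_coset x oN)).
exact: probability_setT.
Qed.

(** The normalized counting measure is the image of Haar measure, so invariance
    and ergodicity pass from [G] to its finite quotients. *)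
Lemma quotient_measureE N (A : set (coset_space N)) : open_normal_subgroup N ->
  quotient_measure R N A = mu (coset_proj N @^-1` A).
Proof.
move=> oN; have := coset_index_haar oN; set k := coset_index R N => k_muN.
have k_neq0 : k != 0%R.
  by apply: contra_eq_neq k_muN => ->; rewrite mul0e eq_sym onee_neq0.
rewrite (measure_coset_union _ oN (fun x => haar_left_coset x oN)).
rewrite /quotient_measure /mscale /= -/k muleC; congr (_ * _).
by rewrite -[mu N]mul1e -(@divff R k)// mulrC EFinM -muleA k_muN mule1.
Qed.

(** Every coset has mass the inverse of the index, which is positive. *)
Lemma haar_coset_union_eq0 N (A : set (coset_space N)) :
  open_normal_subgroup N -> mu (coset_proj N @^-1` A) = 0 -> A = set0.
Proof.
move=> oN A0; rewrite -subset0 => c Ac; have [x xc] := coset_proj_surj c.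
have muN0 : mu N = 0.
  rewrite -(haar_left_coset x oN); apply: subset_measure0 A0.
  - exact: measurable_left_coset.
  - exact: coset_union_measurable.
  - by rewrite -coset_proj_preimage// xc => y /= ->.
by have /esym/eqP := coset_index_haar oN; rewrite muN0 mule0 onee_eq0.
Qed.

(** If each of the [k] cosets of [N] has mass [a], the total mass is [k * a],
    while Haar measure gives each coset mass [1 / k]. *)
Lemma coset_measure_haar m N x :
    open_normal_subgroup N ->
    (forall y z, m (left_coset N y) = m (left_coset N z)) ->
  m (left_coset N x) = m [set: G] * mu (left_coset N x).
Proof.
move=> oN m_const.
rewrite -[[set: G]](preimage_setT (coset_proj N)).
rewrite (measure_coset_union _ oN (fun y => m_const y x)) haar_left_coset//.
rewrite -[LHS]mul1e -(coset_index_haar oN) muleAC /coset_index fineK//.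
by rewrite /counting asboolT//; exact: finite_coset_space.
Qed.

Section uniqueness.
Context {F : set (set G)} (F_open_normal : F `<=` @open_normal_subgroup G).
Hypotheses (F_base : nbhs_base 1%g F) (G2 : @second_countable G).

(** Each level has finitely many cosets, so this is a countable union. *)
Lemma open_bigcup_left_coset {N : nat -> set G} {U : set G} :
    (forall k, open_normal_subgroup (N k)) -> nbhs_base 1%g (range N) ->
    open U ->
  U = \bigcup_k (coset_proj (N k) @^-1`
                   [set c | coset_proj (N k) @^-1` [set c] `<=` U]).
Proof.
move=> oN [_ N_base] Uopen; apply/seteqP; split=> [x Ux|x [k _]]; last exact.
have /N_base[_ [k _ <-] NU] :=
  nbhs_translate (open_nbhs_nbhs (conj Uopen Ux)).
exists k => //= y /esym/(coset_projE (oN k))/NU /=.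
by rewrite mulVKg.
Qed.

Lemma setI_left_coset {N M : set G} x y :
    open_normal_subgroup N -> open_normal_subgroup M -> M `<=` N ->
  left_coset N x `&` left_coset M y = set0 \/
  left_coset N x `&` left_coset M y = left_coset M y.
Proof.
move=> oN oM MN.
have [Nxy|nNxy] := pselect (N (x^-1 * y)%g); [right|left].
  apply/setIidr => z /left_cosetE/MN Nyz; apply/left_cosetE.
  exact: subgroup_trans Nyz.
rewrite -subset0 => z [/left_cosetE Nxz /left_cosetE/MN Nyz]; apply: nNxy.
exact/(subgroup_trans oN Nxz)/subgroup_divC.
Qed.

(** By [coset_measure_haar] both sides agree on cosets. Along a nested base two
    cosets are disjoint or comparable, so these cosets form a pi-system; it
    generates the Borel sets because every open set is a countable union of
    them. This is the source of both invariance and ergodicity of [T]. *)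
Lemma haar_unique m : m [set: G] < +oo ->
    (forall N x y, F N -> m (left_coset N x) = m (left_coset N y)) ->
  forall A : set (borel G), measurable A -> m A = m [set: G] * mu A.
Proof.
move=> m_fin m_const.
have [N [FN N_dec N_base]] := nested_nbhs_base G2 F_base.
have oN k : open_normal_subgroup (N k) by exact: F_open_normal.
have mG_ge0 : (0 <= fine (m [set: G]))%R by exact: fine_ge0.
have mG : (fine (m [set: G]))%:E = m [set: G] by rewrite fineK// ge0_fin_numE.
pose m' := mscale (NngNum mG_ge0) mu.
have m'E C : m' C = m [set: G] * mu C by rewrite -mG.
pose P : set (set (borel G)) :=
  [set C | [\/ C = setT, C = set0 | exists k x, C = left_coset (N k) x]].
move=> B mB; rewrite -m'E.
apply: (@measure_unique _ _ _ P (fun=> setT)) => //.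
- apply/seteqP; split.
    apply: smallest_sub; first exact: smallest_sigma_algebra.
    move=> U Uopen; rewrite (open_bigcup_left_coset oN N_base Uopen).
    apply: (@bigcupT_measurable _ (g_sigma_algebraType P)) => k.
    move: [set c | _] => A.
    rewrite coset_union_bigcup.
    apply: (@fin_bigcup_measurable _ (g_sigma_algebraType P)).
      exact: sub_finite_set (finite_coset_space (oN k) Gcompact).
    move=> c _; have [x <-] := coset_proj_surj c; rewrite coset_proj_preimage//.
    by apply: sub_sigma_algebra; apply: Or33; exists k, x.
  apply: smallest_sub; first exact: sigma_algebra_measurable.
  move=> _ [->|->|[k [x ->]]]; [exact: measurableT|exact: measurable0|].
  exact: measurable_left_coset.
- move=> C D [->|->|[j [x ->]]] PD; first by rewrite setTI.
    by rewrite set0I; exact: Or32.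
  case: PD => [->|->|[k [y ->]]].
  - by rewrite setIT; apply: Or33; exists j, x.
  - by rewrite setI0; exact: Or32.
  case: (leP j k) => [/N_dec/subsetPset Nkj|/ltW/N_dec/subsetPset Njk].
    have [->|->] := setI_left_coset x y (oN j) (oN k) Nkj; first exact: Or32.
    by apply: Or33; exists k, y.
  rewrite setIC.
  have [->|->] := setI_left_coset y x (oN k) (oN j) Njk; first exact: Or32.
  by apply: Or33; exists j, x.
- by move=> _; exact: Or31.
- by rewrite bigcup_const.
- move=> _ [->|->|[k [x ->]]]; last 1 first.
  + rewrite [RHS](m'E _); apply: coset_measure_haar => // y z.
    exact: m_const.
  + by rewrite [RHS](m'E _) probability_setT mule1.
  + by rewrite !measure0.
Qed.
End uniqueness.
End coset_measures.

(** * The metric of a nested sequence of open normal subgroups *)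

Section metric.
Local Open Scope ring_scope.
Context {R : realType}.

(** On the conditions [N k (x^-1 * y)] this gives the distance [1 / (m + 1)],
    where [m] is the first level separating [x] from [y], and [0] if no level
    separates them. *)
Definition first_failure_inv (P : nat -> Prop) : R :=
  if pselect (exists k, `[< ~ P k >]) is left failing
  then (ex_minn failing).+1%:R^-1 else 0.

Lemma first_failure_inv_lt P k : (forall i j, (i <= j)%N -> P j -> P i) ->
  first_failure_inv P < k.+1%:R^-1 <-> P k.
Proof.
move=> P_anti; rewrite /first_failure_inv; case: pselect => [failing|all_true].
  case: ex_minnP => m /asboolP nPm m_min.
  rewrite ltf_pV2 ?posrE ?ltr0n// ltr_nat ltnS; split=> [lt_km|Pk].
    by apply: contrapT => /asboolP/m_min; rewrite leqNgt lt_km.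
  by rewrite ltnNge; apply/negP => /P_anti/(_ Pk).
rewrite invr_gt0 ltr0n; split=> // _.
by apply: contrapT => nPk; apply: all_true; exists k; exact/asboolP.
Qed.

(** No value [1 / (m + 1)] lies strictly between [1 / (k + 2)] and
    [1 / (k + 1)], so the open ball of radius [1 / (k + 1)] is also a closed
    ball. *)
Lemma first_failure_inv_le P k : (forall i j, (i <= j)%N -> P j -> P i) ->
  first_failure_inv P <= k.+2%:R^-1 <-> P k.
Proof.
move=> P_anti; split=> [le_k|].
  apply/(first_failure_inv_lt k P_anti); apply: le_lt_trans le_k _.
  by rewrite ltf_pV2 ?posrE ?ltr0n// ltr_nat.
rewrite /first_failure_inv; case: pselect => [failing|_]; last first.
  by rewrite invr_ge0 ler0n.
case: ex_minnP => m /asboolP nPm _ Pk.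
rewrite lef_pV2 ?posrE ?ltr0n// ler_nat ltnS ltnNge.
by apply/negP => /P_anti/(_ Pk).
Qed.

Lemma first_failure_inv_ge0 P : 0 <= first_failure_inv P.
Proof. by rewrite /first_failure_inv; case: pselect. Qed.

Lemma first_failure_inv_eq0 P : first_failure_inv P = 0 <-> forall k, P k.
Proof.
rewrite /first_failure_inv; case: pselect => [failing|all_true]; split=> //.
- by move=> /eqP; rewrite invr_eq0 pnatr_eq0.
- by have [k /asboolP nPk] := failing; move=> /(_ k).
- move=> _ k; apply: contrapT => nPk.
  by apply: all_true; exists k; exact/asboolP.
Qed.

(** If [P] fails first at [m] then [Q] or [S] has already failed at [m]. *)
Lemma first_failure_inv_triangle P Q S :
    (forall i j, (i <= j)%N -> Q j -> Q i) ->
    (forall i j, (i <= j)%N -> S j -> S i) ->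
    (forall k, Q k -> S k -> P k) ->
  first_failure_inv P <= first_failure_inv Q + first_failure_inv S.
Proof.
move=> Q_anti S_anti QSP; rewrite {1}/first_failure_inv.
case: pselect => [failing|_]; last by rewrite addr_ge0// first_failure_inv_ge0.
case: ex_minnP => m /asboolP nPm _; rewrite leNgt; apply/negP => lt_sum.
apply: nPm; apply: QSP.
  apply/(first_failure_inv_lt m Q_anti); apply: le_lt_trans lt_sum.
  by rewrite lerDl first_failure_inv_ge0.
apply/(first_failure_inv_lt m S_anti); apply: le_lt_trans lt_sum.
by rewrite lerDr first_failure_inv_ge0.
Qed.

Context {G : topologicalGroupType} {N : nat -> set G}.
Hypotheses (oN : forall k, open_normal_subgroup (N k)).
Hypotheses (N_dec : nonincreasing_seq N) (N_base : nbhs_base 1%g (range N)).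

Definition coset_dist (x y : G) : R :=
  first_failure_inv (fun k => N k (x^-1 * y)%g).

Let N_anti z i j : (i <= j)%N -> N j z -> N i z.
Proof. by move=> /N_dec/subsetPset; exact. Qed.

Lemma coset_dist_lt x y k : coset_dist x y < k.+1%:R^-1 <-> N k (x^-1 * y)%g.
Proof. exact/first_failure_inv_lt/N_anti. Qed.

Lemma coset_dist_le x y k : coset_dist x y <= k.+2%:R^-1 <-> N k (x^-1 * y)%g.
Proof. exact/first_failure_inv_le/N_anti. Qed.

(** Symmetry, translation invariance and the isometry property each say that
    two pairs of points separate at the same level. *)
Lemma eq_coset_dist x y x' y' :
    (forall k, N k (x^-1 * y)%g <-> N k (x'^-1 * y')%g) ->
  coset_dist x y = coset_dist x' y'.
Proof.
by move=> eqN; congr first_failure_inv; apply/funext => k; exact/propext.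
Qed.

Lemma coset_dist_metric : hausdorff_space G -> is_metric coset_dist.
Proof.
move=> T2; split=> [x y|x y|x y|x y z].
- exact: first_failure_inv_ge0.
- rewrite /coset_dist first_failure_inv_eq0; split=> [Nxy|-> k]; last first.
    by rewrite mulVg; exact: (subgroup1 (oN k)).
  have xy : (x^-1 * y)%g = 1%g.
    apply/eqP; apply: contrapT => /negP neq1.
    have : nbhs 1%g [set~ (x^-1 * y)%g].
      apply: open_nbhs_nbhs; split; last by apply/eqP; rewrite eq_sym.
      apply: closed_openC; apply: accessible_closed_set1.
      exact: hausdorff_accessible.
    by case/(proj2 N_base) => _ [k _ <-] /(_ _ (Nxy k)) /(_ erefl).
  by rewrite -(mulVKg x y) xy mulg1.
- by apply: eq_coset_dist => k; split; exact: (subgroup_divC (oN k)).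
- apply: first_failure_inv_triangle; [exact: N_anti|exact: N_anti|].
  by move=> k; exact: (subgroup_trans (oN k)).
Qed.

Lemma coset_dist_invariant : translation_invariant coset_dist.
Proof.
move=> x y g; split; apply: eq_coset_dist => k.
  by rewrite invgM -mulgA mulKg.
have -> : ((x * g)^-1 * (y * g))%g = ((x^-1 * y) ^ g)%g.
  by rewrite invgM conjgE !mulgA.
case: (oN k) => _ _ N_normal; split; last exact: N_normal.
by move=> /(N_normal _ g^-1%g); rewrite conjgK.
Qed.

Lemma coset_dist_topology : induces_topology coset_dist.
Proof.
move=> U; split=> [Uopen x Ux|U_ball].
  have /(proj2 N_base)[_ [k _ <-] NU] :=
    nbhs_translate (open_nbhs_nbhs (conj Uopen Ux)).
  exists k.+1%:R^-1; first by rewrite invr_gt0 ltr0n.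
  by move=> y /coset_dist_lt/NU; rewrite /= mulVKg.
rewrite openE => x /U_ball[r r0 rU].
have [k _ /(_ k (leqnn k)) /= lt_r] := near_infty_natSinv_lt (PosNum r0).
apply: (@filterS _ (nbhs x) _ (left_coset (N k) x)).
  move=> y /left_cosetE/coset_dist_lt dxy; apply: rU.
  exact: lt_trans lt_r.
apply: open_nbhs_nbhs; split; first by apply: open_left_coset; case: (oN k).
by apply/left_cosetE; rewrite mulVg; exact: (subgroup1 (oN k)).
Qed.

Lemma coset_dist_ball k : is_metric_ball coset_dist (N k).
Proof.
exists k.+2%:R^-1; first by rewrite invr_gt0 ltr0n.
apply/seteqP; split=> x.
  by move=> Nx; apply/coset_dist_le; rewrite invg1 mul1g.
by move=> /coset_dist_le; rewrite invg1 mul1g.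
Qed.

End metric.

(** * Quotient-preserving maps and their factors *)

Section dynamics.
Local Open Scope ring_scope.
Local Open Scope ereal_scope.
Context {R : realType} {G : topologicalGroupType}.
Hypotheses (Gcompact : compact [set: G]) (G2 : @second_countable G).
Context {mu : probability (borel G) R} (mu_haar : is_haar mu).
Context {T : G -> G} (Tqp : quotient_preserving T).

Lemma finite_factor_coset N x y : finite_factor_set T N ->
  N (x^-1 * y)%g -> N ((T x)^-1 * T y)%g.
Proof.
move=> [oN [f f_induced]] Nxy; apply/(coset_projE oN).
have fE z : coset_proj N (T z) = f (coset_proj N z).
  exact: (congr1 (fun h => h z) f_induced).
by rewrite !fE; congr f; exact/(coset_projE oN).
Qed.

(** Cosets of members of the factor set form a base, and [T] maps cosets of such
    an [N] into cosets of [N]. *)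
Lemma quotient_preserving_continuous : continuous T.
Proof.
move=> x U TxU; case: Tqp => _ /(_ (T x) U TxU).
move=> [_ [[N [y [FN ->]]] yNTx] yNU].
have oN : open_normal_subgroup N by case: FN.
apply: (@filterS _ (nbhs x) _ (left_coset N x)).
  move=> z /left_cosetE/(finite_factor_coset FN) NTxz.
  apply: yNU; apply/left_cosetE.
  by move: yNTx => /left_cosetE Nyx; exact: (subgroup_trans oN Nyx).
apply: open_nbhs_nbhs; split; first by apply: open_left_coset; case: oN.
by apply/left_cosetE; rewrite mulVg; exact: (subgroup1 oN).
Qed.

Lemma quotient_preserving_measurable :
  measurable_fun [set: borel G] (T : borel G -> borel G).
Proof.
apply: (@measurability _ _ _ (borel G) _ _ (@open G)) => // _ [U Uopen <-].
rewrite setTI; apply: sub_sigma_algebra; apply: open_comp => // x _.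
exact: quotient_preserving_continuous.
Qed.

Section factor.
Context {N : set G} {f : coset_space N -> coset_space N}.
Hypotheses (oN : open_normal_subgroup N) (f_induced : induces T f).

Lemma factor_proj x : coset_proj N (T x) = f (coset_proj N x).
Proof. exact: (congr1 (fun h => h x) f_induced). Qed.

Lemma factor_preimage (A : set (coset_space N)) :
  coset_proj N @^-1` (f @^-1` A) = T @^-1` (coset_proj N @^-1` A).
Proof. by apply/seteqP; split=> x /=; rewrite factor_proj. Qed.

Lemma factor_surjective_bijective :
  (forall c, exists c', f c' = c) -> bijective f.
Proof. exact/surjective_bijective/finite_coset_space. Qed.

(** A coset missed by [f] would have empty preimage under [T], hence measure
    zero, whereas cosets have positive measure. *)
Lemma nonsingular_factor_bijective : nonsingular mu T -> bijective f.
Proof.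
move=> [_ T_ns]; apply: factor_surjective_bijective => c.
apply: contrapT => not_image.
suff : [set c] = set0 by move=> /seteqP[/(_ c erefl)].
apply: (haar_coset_union_eq0 Gcompact mu_haar oN).
apply/T_ns; first exact: coset_union_measurable.
rewrite -factor_preimage [f @^-1` _](_ : _ = set0) ?preimage_set0 ?measure0//.
by rewrite -subset0 => c' /= fc'; apply: not_image; exists c'.
Qed.

Lemma preimage_left_coset x : injective f ->
  T @^-1` left_coset N (T x) = left_coset N x.
Proof.
move=> f_inj; rewrite -!coset_proj_preimage// -factor_preimage factor_proj.
by congr (_ @^-1` _); apply/seteqP; split=> c /= => [/f_inj|->].
Qed.

Lemma left_coset_image x : bijective f ->
  exists y, left_coset N x = left_coset N (T y).
Proof.
move=> [g _ gK]; have [y yE] := coset_proj_surj (g (coset_proj N x)).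
by exists y; rewrite -!coset_proj_preimage// factor_proj yE gK.
Qed.

Lemma factor_measure_preserving :
  measure_preserving mu T -> measure_preserving (quotient_measure R N) f.
Proof.
move=> [_ T_mp]; split=> // A _.
rewrite !(quotient_measureE Gcompact mu_haar)// factor_preimage.
by apply: T_mp; exact: coset_union_measurable.
Qed.

Lemma factor_ergodic : ergodic mu T -> ergodic (quotient_measure R N) f.
Proof.
move=> [_ T_erg]; split=> // A _ fA.
rewrite !(quotient_measureE Gcompact mu_haar)//; apply: T_erg.
  exact: coset_union_measurable.
by rewrite -factor_preimage fA.
Qed.

Lemma measure_preserving_factor_bijective :
  measure_preserving (quotient_measure R N) f -> bijective f.
Proof.
move=> [_ f_mp]; apply: factor_surjective_bijective => c.
apply: contrapT => not_image.
suff : [set c] = set0 by move=> /seteqP[/(_ c erefl)].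
apply: (haar_coset_union_eq0 Gcompact mu_haar oN).
rewrite -(quotient_measureE Gcompact mu_haar)// -f_mp//.
rewrite [f @^-1` _](_ : _ = set0) ?measure0//.
by rewrite -subset0 => c' /= fc'; apply: not_image; exists c'.
Qed.

(** Forward orbits are strictly invariant, so ergodicity gives them measure 1,
    and in a finite quotient only the whole space has measure 1. *)
Lemma ergodic_factor_minimal :
    measure_preserving (quotient_measure R N) f ->
    ergodic (quotient_measure R N) f ->
  minimal_map f.
Proof.
move=> /measure_preserving_factor_bijective/bij_inj f_inj [_ f_erg] c.
set O := range _.
have fO : f @^-1` O = O.
  by apply: orbit_invariant => //; exact: (finite_coset_space oN).
have Oc : O c by exists 0%N.
have [|] := f_erg O I fO; rewrite (quotient_measureE Gcompact mu_haar)//.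
  move=> /(haar_coset_union_eq0 Gcompact mu_haar oN) O0.
  by move: Oc; rewrite O0.
move=> O1; rewrite -[LHS]setCK.
suff -> : ~` O = set0 by rewrite setC0.
apply: (haar_coset_union_eq0 Gcompact mu_haar oN).
rewrite preimage_setC probability_setC; last first.
  exact: (coset_union_measurable Gcompact O oN).
by rewrite O1 subee.
Qed.

End factor.

Section base.
Context {F : set (set G)} (F_sub : F `<=` finite_factor_set T).
Hypothesis F_base : nbhs_base (1%g : G) F.
Context {TN : forall N : set G, coset_space N -> coset_space N}.
Hypothesis TN_induced : forall N, F N -> induces T (@TN N).

Let F_open_normal : F `<=` @open_normal_subgroup G.
Proof. by move=> N /F_sub[]. Qed.

(** [T] has compact, hence closed, image, and that image meets every coset of
    every member of the base. *)
Lemma factors_bijective_surjective : hausdorff_space G ->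
  (forall N, F N -> bijective (@TN N)) -> range T = [set: G].
Proof.
move=> T2 TN_bij.
have T_closed : closed (range T).
  apply: compact_closed => //; apply: continuous_compact => //.
  exact/continuous_subspaceT/quotient_preserving_continuous.
apply/seteqP; split=> // y _; apply: contrapT => not_image.
have /nbhs_translate/(proj2 F_base)[N FN NC] : nbhs y (~` range T).
  by apply: open_nbhs_nbhs; split=> //; exact: closed_openC.
have oN := F_open_normal FN; have [g _ gK] := TN_bij N FN.
have [z zE] := coset_proj_surj (g (coset_proj N y)).
have /(coset_projE oN)/NC /= : coset_proj N y = coset_proj N (T z).
  by rewrite (factor_proj (TN_induced FN)) zE gK.
by apply; exists z => //; rewrite mulVKg.
Qed.

(** The image of [mu] under [T] gives all cosets of [N] the same mass, since
    their preimages are again cosets of [N]. *)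
Lemma factors_bijective_measure_preserving :
  (forall N, F N -> bijective (@TN N)) -> measure_preserving mu T.
Proof.
move=> TN_bij; split; first exact: quotient_preserving_measurable.
move=> A mA.
pose m := measure_function_pushforward__canonical__measure_function_Measure
  mu quotient_preserving_measurable.
have mE B : m B = mu (T @^-1` B) by [].
have mG : m [set: G] = 1 by rewrite mE preimage_setT probability_setT.
suff : m A = m [set: G] * mu A by rewrite mG mul1e.
apply: (haar_unique Gcompact mu_haar F_open_normal F_base G2) => //.
  by rewrite mG ltry.
move=> N x y FN; rewrite !mE; have oN := F_open_normal FN.
have TN_inj := bij_inj (TN_bij N FN).
have [x' ->] := left_coset_image oN (TN_induced FN) x (TN_bij N FN).
have [y' ->] := left_coset_image oN (TN_induced FN) y (TN_bij N FN).
rewrite !(preimage_left_coset oN (TN_induced FN) _ TN_inj).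
by rewrite !(haar_left_coset mu_haar).
Qed.

(** An invariant set [A] meets all cosets of [N] in the same mass, because
    [TN N] permutes them transitively; so [A] is independent of every Borel
    set, in particular of itself. *)
Lemma factors_minimal_ergodic : measure_preserving mu T ->
  (forall N, F N -> minimal_map (@TN N)) -> ergodic mu T.
Proof.
move=> [T_meas T_mp] TN_min; split=> // A mA TA.
pose m := measure_function_mrestr__canonical__measure_function_Measure mu mA.
have mE B : m B = mu (B `&` A) by [].
have mG : m [set: G] = mu A by rewrite mE setTI.
have A_indep : mu A = mu A * mu A.
  suff : m A = m [set: G] * mu A by rewrite mG mE setIid.
  apply: (haar_unique Gcompact mu_haar F_open_normal F_base G2) => //.
    rewrite mG; apply: le_lt_trans (probability_le1 mu mA) _; exact: ltry.
  move=> N x y FN; have oN := F_open_normal FN.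
  have finN := finite_coset_space oN Gcompact.
  have TN_inj := bij_inj (minimal_bijective finN (TN_min N FN)).
  have m_step z : m (left_coset N (T z)) = m (left_coset N z).
    rewrite !mE -[in RHS](preimage_left_coset oN (TN_induced FN) z TN_inj).
    rewrite -[in RHS]TA -preimage_setI T_mp//.
    by apply: measurableI => //; exact: measurable_left_coset.
  have : [set: coset_space N] (coset_proj N y) by [].
  rewrite -(TN_min N FN (coset_proj N x)) => -[n _].
  have -> : iter n (@TN N) (coset_proj N x) = coset_proj N (iter n T x).
    by elim: n => //= n ->; rewrite (factor_proj (TN_induced FN)).
  move=> /(congr1 val) /= <-; elim: n => //= n ->; exact/esym/m_step.
have A_fin : (fine (mu A))%:E = mu A by rewrite fineK// fin_num_measure.
move: A_indep; rewrite -A_fin -EFinM => -[] /eqP.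
rewrite -subr_eq0 -{1}[fine _]mulr1 -mulrBr mulf_eq0 subr_eq0.
move=> /orP[/eqP p0|/eqP p1]; [left|right]; rewrite -[LHS]A_fin.
  by rewrite p0.
by rewrite -p1.
Qed.

(** Along a nested base taken from [F], a surjective [T] permutes the cosets at
    every level, so it preserves the level at which two points separate. *)
Lemma surjective_isometry : hausdorff_space G -> range T = [set: G] ->
  exists d : G -> G -> R,
    [/\ is_metric d, induces_topology d, translation_invariant d,
        is_isometry d T &
        nbhs_base (1%g : G) [set N | F N /\ is_metric_ball d N]].
Proof.
move=> T2 T_surj.
have [N [FN N_dec N_base]] := nested_nbhs_base G2 F_base.
have oN k : open_normal_subgroup (N k) by exact: F_open_normal.
exists (coset_dist (N := N)); split.
- exact: coset_dist_metric.
- exact: coset_dist_topology.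
- exact: coset_dist_invariant.
- move=> x y; apply: eq_coset_dist => k; split; last first.
    exact: (finite_factor_coset (F_sub (FN k))).
  have fT := factor_proj (TN_induced (FN k)).
  have /bij_inj TN_inj : bijective (@TN (N k)).
    apply: (factor_surjective_bijective (oN k)) => c.
    have [y' <-] := coset_proj_surj c.
    have [x' _ <-] : range T y' by rewrite T_surj.
    by exists (coset_proj (N k) x'); rewrite fT.
  by move=> /(coset_projE (oN k)); rewrite !fT => /TN_inj/(coset_projE (oN k)).
- case: F_base => F_nbhs _; case: (N_base) => _ N_small.
  split=> [M [/F_nbhs//]|U /N_small[_ [k _ <-] NU]].
  by exists (N k) => //; split=> //; exact: coset_dist_ball.
Qed.

End base.

(** If [N] is the ball of radius [r], then [x] and [y] share a coset of [N]
    exactly when their distance is at most [r], which an isometry respects. *)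
Lemma isometry_factor_injective {d : G -> G -> R} {N : set G}
    {f : coset_space N -> coset_space N} :
    open_normal_subgroup N -> induces T f ->
    translation_invariant d -> is_isometry d T -> is_metric_ball d N ->
  injective f.
Proof.
move=> oN f_induced d_inv T_iso [r _ NE] c c'.
have NdE x y : N (x^-1 * y)%g <-> (d x y <= r)%R.
  by rewrite NE /= -(proj1 (d_inv _ _ x)) mulg1 mulVKg.
have [x <-] := coset_proj_surj c; have [y <-] := coset_proj_surj c'.
rewrite -!(factor_proj f_induced) => /(coset_projE oN)/NdE.
by rewrite T_iso => /NdE/(coset_projE oN).
Qed.

End dynamics.

(** * The two equivalences *)

Theorem theorem1p1 (R : realType) (G : topologicalGroupType)
    (Gprofinite : profinite G) (G2 : @second_countable G)
    (mu : probability (borel G) R) (mu_haar : is_haar mu)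
    (T : G -> G) (Tqp : quotient_preserving T)
    (F : set (set G)) (F_sub : F `<=` finite_factor_set T)
    (F_base : nbhs_base (1%g : G) F)
    (TN : forall N : set G, coset_space N -> coset_space N)
    (TN_induced : forall N, finite_factor_set T N -> induces T (TN N)) :
  [<-> measure_preserving mu T;
       nonsingular mu T;
       forall N, F N -> bijective (TN N);
       range T = [set: G];
       exists d : G -> G -> R,
         [/\ is_metric d, induces_topology d, translation_invariant d,
             is_isometry d T &
             nbhs_base (1%g : G) [set N | F N /\ is_metric_ball d N]]]
  /\
  [<-> measure_preserving mu T /\ ergodic mu T;
       forall N, F N -> measure_preserving (quotient_measure R N) (TN N) /\
                        ergodic (quotient_measure R N) (TN N);
       forall N, F N -> minimal_map (TN N)].
Proof.
have [Gcompact T2 _] := Gprofinite.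
have oN N : F N -> open_normal_subgroup N by move=> /F_sub[].
have TN_F N : F N -> induces T (TN N) by move=> /F_sub/TN_induced.
(* The metric only singles out a subfamily of [F] that is still a base, so
     invariance is derived from an arbitrary such subfamily. *)
  have bij_mp F' : F' `<=` F -> nbhs_base (1%g : G) F' ->
    (forall N, F' N -> bijective (TN N)) -> measure_preserving mu T.
  move=> F'F F'_base.
  exact: (factors_bijective_measure_preserving Gcompact G2 mu_haar Tqp
            (subset_trans F'F F_sub) F'_base (fun N F'N => TN_F N (F'F N F'N))).
split; tfae.
- by move=> [T_meas T_mp]; split=> // A mA; rewrite T_mp.
- move=> T_ns N FN.
  exact: (nonsingular_factor_bijective Gcompact mu_haar (oN N FN) (TN_F N FN)).
- exact: (factors_bijective_surjective Gcompact Tqp F_sub F_base TN_F T2).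
- exact: (surjective_isometry Gcompact G2 F_sub F_base TN_F T2).
- move=> [d [d_metric d_top d_inv T_iso d_base]].
  apply: bij_mp d_base _ => [N []//|N [FN N_ball]].
  apply: injective_bijective; first exact: (finite_coset_space (oN N FN)).
  exact: (isometry_factor_injective (oN N FN) (TN_F N FN) d_inv T_iso N_ball).
- move=> [T_mp T_erg] N FN; split.
    exact: (factor_measure_preserving Gcompact mu_haar (oN N FN) (TN_F N FN)).
  exact: (factor_ergodic Gcompact mu_haar (oN N FN) (TN_F N FN)).
- move=> TN_erg N FN; have [TN_mp TN_e] := TN_erg N FN.
  exact: (ergodic_factor_minimal Gcompact mu_haar (oN N FN) TN_mp TN_e).
- move=> TN_min.
  have T_mp : measure_preserving mu T.
    apply: bij_mp F_base _ => // N FN; apply: minimal_bijective (TN_min N FN).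
    exact: (finite_coset_space (oN N FN)).
  split=> //.
  exact: (factors_minimal_ergodic Gcompact G2 mu_haar F_sub F_base TN_F T_mp).
Qed.
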